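(* Consider a Bayesian inverse problem with prior $\mu_{\mathrm{prior}}$ and likelihood $L$. Suppose that the following hold for $\mu_{\mathrm{prior}}$-almost every $\theta'\in X$ and every $y^\dagger\in Y$: (A1) $L(\cdot|\theta')$ is a strictly positive probability density function (with respect to $\nu_Y$); (A2) $L(y^\dagger|\cdot)\in \mathbf{L}^1(X,\mu_{\mathrm{prior}})$; (A3) there exists $g\in\mathbf{L}^1(X,\mu_{\mathrm{prior}})$ such that $L(y^\ddagger|\cdot)\le g$ for all $y^\ddagger\in Y$; (A4) $L(\cdot|\theta')$ is continuous on $Y$. Then the Bayesian inverse problem is weakly well-posed, Hellinger well-posed, and total variation well-posed.
   Context: Setting. $(Y,\|\cdot\|_Y)$ is a separable Banach space (data space). The parameter space $X$ is a measurable subset of a separable, completely metrisable topological vector space $(X',\mathcal{T}')$. $X$ and $Y$ carry their Borel $\sigma$-algebras $\mathcal{B}X$, $\mathcal{B}Y$. $\mathrm{Prob}(X)$ is the set of probability measures on $(X,\mathcal{B}X)$, and $\mathrm{Prob}(X,\mu)$ is the set of those that are absolutely continuous with respect to $\mu$. $\nu_X$ and $\nu_Y$ are $\sigma$-finite measures on $(X,\mathcal{B}X)$ and $(Y,\mathcal{B}Y)$. The prior $\mu_{\mathrm{prior}}\in\mathrm{Prob}(X)$ satisfies $\mu_{\mathrm{prior}}\ll\nu_X$ with density $\pi_{\mathrm{prior}}$. The likelihood $L(y^\dagger|\theta')\ge 0$ is defined for every $y^\dagger\in Y$ and $\mu_{\mathrm{prior}}$-a.e. $\theta'\in X$; $L(\cdot|\theta')$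 is the $\nu_Y$-density of the conditional distribution of the data $y$ given $\theta=\theta'$, and $L(y^\dagger|\cdot)$ is measurable. Put $Z(y^\dagger):=\int_X L(y^\dagger|\theta)\,\mathrm{d}\mu_{\mathrm{prior}}(\theta)$. Bayesian inverse problem: for data $y^\dagger\in Y$, find the posterior $\mu_{\mathrm{post}}^\dagger\in\mathrm{Prob}(X,\mu_{\mathrm{prior}})$ with $\nu_X$-density $\theta\mapsto L(y^\dagger|\theta)\pi_{\mathrm{prior}}(\theta)/Z(y^\dagger)$. Well-posedness: let $(\mathrm{P},d)$ be a metric space with $\mathrm{P}\subseteq\mathrm{Prob}(X)$. The Bayesian inverse problem is $(\mathrm{P},d)$-well-posed if (1) for every $y^\dagger\in Y$, $\mu_{\mathrm{post}}^\dagger\in\mathrm{P}$ exists, (2) it is unique in $\mathrm{P}$, and (3) the map $(Y,\|\cdot\|_Y)\ni y^\dagger\mapsto\mu_{\mathrm{post}}^\dagger\in(\mathrm{P},d)$ is continuous. - Weak well-posedness: $(\mathrm{P},d)=(\mathrm{Prob}(X),\mathrm{d}_{\mathrm{Prok}})$, where $\mathrm{d}_{\mathrm{Prok}}(\mu,\mu'):=\inf\{\varepsilon>0:\mu(B)\le\mu'(B^\varepsilon)+\varepsilon \text{ for all } B\in\mathcal{B}X\}$ and $B^\varepsilon:=\{b\in X:\ \exists b'\in B,\ d_X(b,b')<\varepsilon\}$, with $d_X$ a metric inducing the topology of $X$ ($d_X(b,b')=\|b-b'\|_X$ if $X$ is normed). - Total variation well-posedness: $(\mathrm{P},d)=(\mathrm{Prob}(X),\mathrm{d}_{\mathrm{tv}})$,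 where $\mathrm{d}_{\mathrm{tv}}(\mu,\mu'):=\sup_{B\in\mathcal{B}X}|\mu(B)-\mu'(B)|$. - Hellinger well-posedness: $(\mathrm{P},d)=(\mathrm{Prob}(X,\mu_{\mathrm{prior}}),\mathrm{d}_{\mathrm{Hel}})$, where $\mathrm{d}_{\mathrm{Hel}}(\mu,\mu'):=\sqrt{\tfrac12\int\left(\sqrt{\mathrm{d}\mu'/\mathrm{d}\mu_{\mathrm{prior}}}-\sqrt{\mathrm{d}\mu/\mathrm{d}\mu_{\mathrm{prior}}}\right)^2\mathrm{d}\mu_{\mathrm{prior}}}$. *)

(* Defs.v *)
From HB Require Import structures.
From mathcomp Require Import all_boot all_order all_algebra.
From mathcomp Require Import all_classical all_reals all_analysis.
From mathcomp Require Import giry.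

Set Implicit Arguments.
Unset Strict Implicit.
Unset Printing Implicit Defensive.

Import Order.TTheory GRing.Theory Num.Theory.
Import numFieldNormedType.Exports.

Local Open Scope classical_set_scope.
Local Open Scope ring_scope.

Notation borel T := (g_sigma_algebraType (@open T)).

(* A subset with its subspace topology. The library's measurable types are
   pointed, hence the base point [a0]; nothing else depends on it. *)
Definition pointed_subspace (T : topologicalType) (A : set T) (a0 : A) : Type :=
  A.

HB.instance Definition _ (T : topologicalType) (A : set T) (a0 : A) :=
  Topological.copy (pointed_subspace a0) (set_type A).
HB.instance Definition _ (T : topologicalType) (A : set T) (a0 : A) :=
  isPointed.Build (pointed_subspace a0) a0.

Section metrics.
Context {R : realType}.

(* [d] is a metric on the subset [P] of [T], equality of points being [eqv]. *)
Definition metric_on (T : Type) (eqv : T -> T -> Prop) (P : set T)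
    (d : T -> T -> R) : Prop :=
  [/\ forall x y, P x -> P y -> 0 <= d x y,
      forall x y, P x -> P y -> (d x y = 0 <-> eqv x y),
      forall x y, P x -> P y -> d x y = d y x &
      forall x y z, P x -> P y -> P z -> d x z <= d x y + d y z].

Definition metric_for_topology (T : topologicalType) (d : T -> T -> R) : Prop :=
  metric_on eq [set: T] d /\
  forall A : set T, open A <->
    forall x, A x -> exists2 e : R, 0 < e & [set y | d x y < e] `<=` A.

Definition completely_metrizable (T : topologicalType) : Prop :=
  exists2 d : T -> T -> R, metric_for_topology d &
    forall u : nat -> T,
      (forall e : R, 0 < e -> exists N : nat,
         forall m n, (N <= m)%N -> (N <= n)%N -> d (u m) (u n) < e) ->
      exists l : T, u @ \oo --> l.

End metrics.

Definition separable (T : topologicalType) : Prop :=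
  exists2 D : set T, countable D & dense D.

Section densities.
Context {disp : measure_display} {T : measurableType disp} {R : realType}.

Definition is_density (nu : {measure set T -> \bar R}) (mu : set T -> \bar R)
    (f : T -> R) : Prop :=
  [/\ measurable_fun [set: T] f,
      {ae nu, forall x, 0 <= f x} &
      forall A, measurable A -> mu A = (\int[nu]_(x in A) (f x)%:E)%E].

Definition is_prob_density (nu : {measure set T -> \bar R}) (f : T -> R) :
    Prop :=
  [/\ measurable_fun [set: T] f,
      {ae nu, forall x, 0 <= f x} &
      (\int[nu]_x (f x)%:E = 1)%E].

End densities.

Section distances.
Context {disp : measure_display} {X : measurableType disp} {R : realType}.
Implicit Types (mu : probability X R) (d : X -> X -> R).

Definition enlargement d (e : R) (B : set X) : set X :=
  [set b | exists2 b', B b' & d b b' < e].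

Definition prokhorov d mu mu' : R :=
  inf [set e : R | 0 < e /\
    forall B, measurable B -> (mu B <= mu' (enlargement d e B) + e%:E)%E].

Definition tv_distance mu mu' : R :=
  sup [set `|fine (mu B) - fine (mu' B)| | B in measurable].

(* Radon-Nikodym density of [mu] with respect to [nu] (meaningful when
   [mu `<< nu]); it is finite everywhere, so [fine] loses nothing. *)
Definition rn_density (nu mu : probability X R) (x : X) : R :=
  fine (Radon_Nikodym (charge_of_finite_measure mu) nu x).

Definition hellinger (prior mu mu' : probability X R) : R :=
  Num.sqrt (2^-1 * \int[prior]_x
    (Num.sqrt (rn_density prior mu' x) - Num.sqrt (rn_density prior mu x)) ^+ 2).

End distances.

Section bayesian_inverse_problem.
Context {dispX dispY : measure_display}.
Context {X : measurableType dispX} {Y : measurableType dispY} {R : realType}.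

(* [K t] is the conditional distribution of the data given the parameter [t].
   [L] is total; its values for [t] in a [prior]-null set are immaterial. *)
Definition is_likelihood (nuY : {measure set Y -> \bar R})
    (prior : probability X R) (K : R.-pker X ~> Y) (L : Y -> X -> R) :
    Prop :=
  [/\ forall y, measurable_fun [set: X] (L y),
      {ae prior, forall t, forall y, 0 <= L y t} &
      {ae prior, forall t, is_density nuY (K t) (L ^~ t)}].

Definition evidence (prior : probability X R) (L : Y -> X -> R) (y : Y) : R :=
  \int[prior]_t L y t.

Definition posterior (nuX : {measure set X -> \bar R}) (prior : probability X R)
    (pi_prior : X -> R) (L : Y -> X -> R) (y : Y) : set (probability X R) :=
  [set mu | mu `<< prior /\
    is_density nuX mu (fun t => L y t * pi_prior t / evidence prior L y)].

End bayesian_inverse_problem.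

(* [post y] is the set of posteriors for the data [y]. Probability measures are
   identified when they agree on measurable sets ([measure_eq]): the library's
   measures are functions on all sets. *)
Definition well_posed (disp : measure_display) (X : measurableType disp)
    (R : realType) (Y : topologicalType) (post : Y -> set (probability X R))
    (P : set (probability X R)) (d : probability X R -> probability X R -> R) :
    Prop :=
  metric_on (fun mu mu' : probability X R => measure_eq mu mu') P d /\
  exists mupost : Y -> probability X R,
    [/\ forall y, P (mupost y) /\ post y (mupost y),
        forall y mu, P mu -> post y mu -> measure_eq mu (mupost y) &
        forall y0, d (mupost y0) (mupost y) @[y --> y0] --> (0 : R)].

(* Main.v *)
Require Import Defs.
From HB Require Import structures.
From mathcomp Require Import all_boot all_order all_algebra.
From mathcomp Require Import all_classical all_reals all_analysis.
From mathcomp Require Import measurable_realfun giry ring lra.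

Set Implicit Arguments.
Unset Strict Implicit.
Unset Printing Implicit Defensive.

Import Order.TTheory GRing.Theory Num.Theory.
Import numFieldNormedType.Exports.

Local Open Scope classical_set_scope.
Local Open Scope ring_scope.

(** By [A1] and [A2] the evidence [Z y], the prior integral of [L y], is a
    positive real number, so that [f y = L y / Z y] is a probability density
    with respect to the prior. The measure it defines has density
    [L y * pi_prior / Z y] with respect to [nuX] ([is_density_mul]): it is a
    posterior, and the only one, since a density determines its measure.

    By the continuity of the likelihood ([A4]), the bound [A3] and dominated
    convergence, [L y] depends continuously on [y] as an element of L1 of the
    prior ([L1_likelihood_cvg]). Writing [|.|] for the L1 norm, the identity
    [Z y0 * (f y - f y0) = (Z y0 - Z y) * f y + (L y - L y0)] gives
    [Z y0 * |f y - f y0| <= 2 * |L y - L y0|], hence the posterior density is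
    also continuous in L1 ([posterior_L1_cvg]).

    This one fact yields the three kinds of continuity. The total variation
    distance is at most the L1 distance of the densities ([tv_le_L1]), the
    Hellinger distance at most its square root ([hellinger_le_L1]), and the
    Prokhorov distance at most the total variation distance
    ([prokhorov_le_tv]).

    It remains to see that the three distances are metrics. For the Hellinger
    distance, a multiple of the L2 distance of the square roots of the
    densities, the triangle inequality is Minkowski's. If the Prokhorov
    distance of two measures is 0, they agree on closed sets, which are
    intersections of their enlargements, hence on all Borel sets. *)

(** * Sequential limits *)

(** Only the domain has to be pseudometric for sequences to detect the limit of
    a function at a point. *)
Lemma cvg_at_seq (R : realType) (S : pseudoMetricType R) (V : topologicalType)
    (f : S -> V) (p : S) (l : V) :
  (forall u : nat -> S, u @ \oo --> p -> f \o u @ \oo --> l) ->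
  f y @[y --> p] --> l.
Proof.
move=> fl A Al; apply: contrapT => nA.
have u_ n : exists x, ball p n.+1%:R^-1 x /\ ~ A (f x).
  apply: contrapT => /forallNP h; apply: nA.
  have pn : nbhs p (ball p n.+1%:R^-1) by apply: nbhsx_ballx; rewrite invr_gt0.
  by apply: filterS pn => x px; apply: contrapT => nAx; exact: (h x).
have [u uP] := choice u_.
have up : u @ \oo --> p.
  apply/cvg_ballP => e e0; near=> n.
  apply: (@le_ball _ _ _ n.+1%:R^-1); last exact: (uP n).1.
  rewrite -[leRHS]invrK lef_pV2 ?posrE ?invr_gt0//.
  near: n; exists (Num.truncn e^-1) => // s /= rs.
  by apply/ltW; rewrite -truncn_le_nat.
have [N _ /(_ N (leqnn N))] := fl u up A Al.
exact: (uP N).2.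
Unshelve. all: end_near. Qed.

(** * The Prokhorov metric *)

Section prokhorov_metric.
Context {R : realType} {T : ptopologicalType}.
Variable d : T -> T -> R.
Hypothesis dP : metric_for_topology d.
Implicit Types (mu : probability (borel T) R) (B : set (borel T)) (e : R).

Local Notation enlarge := (enlargement (X := borel T) d).
Local Notation prok := (prokhorov (X := borel T) d).

Let d_refl x : d x x = 0. Proof. by have [[_ + _ _] _] := dP => ->. Qed.
Let d_sym x y : d x y = d y x. Proof. by have [[_ _ + _] _] := dP => ->. Qed.
Let d_triangle x y z : d x z <= d x y + d y z.
Proof. by have [[_ _ _ +] _] := dP; exact. Qed.

Lemma open_enlargement e B : open (enlarge e B : set T).
Proof.
have [_ openP] := dP; apply/openP => b [b' Bb' bb'].
exists (e - d b b'); first by rewrite subr_gt0.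
move=> y /= yb; exists b' => //; rewrite d_sym in yb.
by apply: le_lt_trans (d_triangle y b b') _; rewrite -ltrBrDr.
Qed.

Lemma measurable_enlargement e B : measurable (enlarge e B).
Proof. by apply: sub_sigma_algebra; exact: open_enlargement. Qed.

Lemma sub_enlargement e B : 0 < e -> B `<=` enlarge e B.
Proof. by move=> e0 x Bx; exists x => //; rewrite d_refl. Qed.

Lemma enlargement_enlargement e1 e2 B :
  enlarge e2 (enlarge e1 B) `<=` enlarge (e1 + e2) B.
Proof.
move=> x [y [z Bz yz] xy]; exists z => //.
by apply: le_lt_trans (d_triangle x y z) _; rewrite addrC ltrD.
Qed.

Lemma enlargement_setC e B :
  enlarge e (~` enlarge e B) `<=` ~` B.
Proof. by move=> x [y yB xy] Bx; apply: yB; exists x => //; rewrite d_sym. Qed.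

(** The set of which [prok mu mu'] is the infimum. *)
Definition prokhorov_bounds mu mu' : set R := [set e : R | 0 < e /\
  forall B, measurable B -> (mu B <= mu' (enlarge e B) + e%:E)%E].

Lemma prokhorov_bounds_ge0 mu mu' e : prokhorov_bounds mu mu' e -> 0 <= e.
Proof. by case=> /ltW. Qed.

Lemma prokhorov_bounds1 mu mu' : prokhorov_bounds mu mu' 1.
Proof.
split=> // B mB; apply: (le_trans (probability_le1 mu mB)).
by rewrite leeDr.
Qed.

Lemma has_inf_prokhorov_bounds mu mu' : has_inf (prokhorov_bounds mu mu').
Proof.
split; first by exists 1; exact: prokhorov_bounds1.
by exists 0 => e /prokhorov_bounds_ge0.
Qed.

Lemma prokhorov_le mu mu' e : prokhorov_bounds mu mu' e ->
  prok mu mu' <= e.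
Proof. by apply: ge_inf; exists 0 => x /prokhorov_bounds_ge0. Qed.

(** The admissible bounds are upward closed. *)
Lemma prokhorov_gt mu mu' e : prok mu mu' < e ->
  prokhorov_bounds mu mu' e.
Proof.
move=> /(inf_lt (has_inf_prokhorov_bounds mu mu').1)[e' [e'0 be'] e'e].
split; first exact: lt_trans e'e.
move=> B mB; apply: le_trans (be' B mB) _; apply: leeD.
  rewrite le_measure ?inE//; [exact: measurable_enlargement..|].
  by move=> x [y By xy]; exists y => //; exact: lt_trans xy e'e.
by rewrite lee_fin ltW.
Qed.

Lemma prokhorov_ge0 mu mu' : 0 <= prok mu mu'.
Proof.
apply: lb_le_inf; first by exists 1; exact: prokhorov_bounds1.
by move=> e /prokhorov_bounds_ge0.
Qed.

(** Symmetry of the Prokhorov distance: apply the defining inequality to the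
    complement of an enlargement. *)
Lemma prokhorov_bounds_sym mu mu' :
  prokhorov_bounds mu mu' `<=` prokhorov_bounds mu' mu.
Proof.
move=> e [e0 be]; split=> // B mB.
have mBe := measurable_enlargement e B.
have := be _ (measurableC mBe).
have : (mu' (enlarge e (~` enlarge e B)) <= mu' (~` B))%E.
  rewrite le_measure ?inE//; [exact: measurable_enlargement|exact: measurableC|].
  exact: enlargement_setC.
rewrite !probability_setC//.
move: (fin_num_measure mu' _ mB) (fin_num_measure mu _ mBe).
move: (fin_num_measure mu' _
  (measurable_enlargement e (~` enlarge e B))).
move=> /fineK <- /fineK <- /fineK <-.
rewrite -!EFinB -EFinD !lee_fin; lra.
Qed.

Lemma prokhorov_sym mu mu' : prok mu mu' = prok mu' mu.
Proof.
congr inf; apply/seteqP; split; exact: prokhorov_bounds_sym.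
Qed.

Lemma prokhorov_triangle mu1 mu2 mu3 :
  prok mu1 mu3 <= prok mu1 mu2 + prok mu2 mu3.
Proof.
apply/ler_addgt0Pr => e e0.
have e20 : 0 < e / 2 by rewrite divr_gt0.
have /prokhorov_gt[a0 aP] : prok mu1 mu2 < prok mu1 mu2 + e / 2.
  by rewrite ltrDl.
have /prokhorov_gt[b0 bP] : prok mu2 mu3 < prok mu2 mu3 + e / 2.
  by rewrite ltrDl.
set a := _ + e / 2 in a0 aP; set b := _ + e / 2 in b0 bP.
rewrite (_ : _ + e = a + b); last by rewrite /a /b; field.
apply: prokhorov_le; split; first exact: addr_gt0.
move=> B mB; apply: (le_trans (aP B mB)).
rewrite (addrC a b) (EFinD b a) addeA; apply: leeD => //.
apply: (le_trans (bP _ (measurable_enlargement a B))).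
apply: leeD => //; rewrite le_measure ?inE//; [exact: measurable_enlargement..|].
by rewrite (addrC b a); exact: enlargement_enlargement.
Qed.

(** A closed set is the decreasing intersection of its enlargements. *)
Lemma closed_enlargement (F : set T) : closed F ->
  \bigcap_n enlarge n.+1%:R^-1 F = F.
Proof.
move=> cF; apply/seteqP; split=> [x xF|x Fx n _]; last first.
  exact: sub_enlargement.
apply: contrapT => Fx; have [_ openP] := dP.
have /openP/(_ x Fx)[e e0 eF] : open (~` F) by rewrite openC.
have [y Fy xy] := xF (Num.truncn e^-1) I; apply: (eF y) Fy => /=.
apply: lt_le_trans xy _.
rewrite -[leRHS]invrK lef_pV2 ?posrE ?invr_gt0//.
by apply/ltW; rewrite -truncn_le_nat.
Qed.

(** Along [e = 1 / (n + 1)], [mu F <= mu' (enlarge e F) + e], and the right-hand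
    side tends to [mu' F]. *)
Lemma prokhorov0_closed mu mu' (F : set T) : prok mu mu' = 0 ->
  closed F -> (mu F <= mu' F)%E.
Proof.
move=> dmu0 cF.
have mF : measurable (F : set (borel T)).
  by rewrite -[F]setCK; apply: measurableC; apply: sub_sigma_algebra;
    rewrite openC.
pose E n : set (borel T) := enlarge n.+1%:R^-1 F.
have mE n : measurable (E n) by exact: measurable_enlargement.
have EF : \bigcap_n E n = F by exact: closed_enlargement.
have cvgE : mu' (E n) @[n --> \oo] --> mu' F.
  rewrite -[in X in _ --> X]EF; apply: nonincreasing_cvg_mu => //.
  - by rewrite -ge0_fin_numE// fin_num_measure.
  - exact: bigcapT_measurable.
  - apply/nonincreasing_seqP => n; apply/subsetPset => x [y Fy xy].
    exists y => //; apply: lt_le_trans xy _.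
    by rewrite lef_pV2 ?posrE// ler_nat.
have cvgEn : (mu' (E n) + n.+1%:R^-1%:E)%E @[n --> \oo] --> mu' F.
  rewrite -[X in _ --> X]adde0; apply: cvgeD => //.
    by rewrite fin_num_adde_defl.
  apply/cvg_EFin; first exact: nearW.
  exact: cvg_harmonic.
apply: (cvge_ge _ cvgEn); apply: nearW => n.
have [] // : prokhorov_bounds mu mu' n.+1%:R^-1.
  by apply: prokhorov_gt; rewrite dmu0.
by move=> _ /(_ F mF).
Qed.

Lemma prokhorov_eq0 mu mu' : prok mu mu' = 0 <-> measure_eq mu mu'.
Proof.
split=> [dmu0|mumu'].
  have mumu'C (F : set T) : closed F -> mu F = mu' F.
    move=> cF; apply/eqP; rewrite eq_le !prokhorov0_closed//.
    by rewrite prokhorov_sym.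
  move=> A mA.
  apply: (measure_unique (@open T : set (set (borel T))) (fun=> setT)) => //.
  - exact: openI.
  - move=> _; exact: openT.
  - by rewrite bigcup_const.
  - move=> U oU.
    have mU : measurable (U : set (borel T)) by exact: sub_sigma_algebra.
    have := mumu'C _ (open_closedC oU).
    rewrite !probability_setC//.
    move: (fin_num_measure mu _ mU) (fin_num_measure mu' _ mU).
    move=> /fineK <- /fineK <-; rewrite -!EFinB => -[].
    move=> mumu'U; rewrite -[LHS]fineK ?fin_num_measure//.
    rewrite -[RHS]fineK ?fin_num_measure//; congr EFin.
    by apply: oppr_inj; apply: (addrI 1).
  - by move=> _; rewrite -ge0_fin_numE// fin_num_measure.
apply/eqP; rewrite eq_le prokhorov_ge0 andbT.
apply/ler_addgt0Pr => e e0; rewrite add0r; apply: prokhorov_le; split=> //.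
move=> B mB; rewrite mumu'//.
apply: (@le_trans _ _ (mu' (enlarge e B))).
  rewrite le_measure ?inE//; first exact: measurable_enlargement.
  exact: sub_enlargement.
by rewrite leeDl// lee_fin ltW.
Qed.

Lemma prokhorov_metric : metric_on (fun mu mu' => measure_eq mu mu')
  [set: probability (borel T) R] prok.
Proof.
split=> *; [exact: prokhorov_ge0|exact: prokhorov_eq0|exact: prokhorov_sym|].
exact: prokhorov_triangle.
Qed.

End prokhorov_metric.

(** * The total variation metric *)

Section tv_metric.
Context {disp : measure_display} {X : measurableType disp} {R : realType}.
Implicit Types (mu : probability X R) (B : set X) (e : R).

Lemma tv_ge mu mu' B : measurable B ->
  `|fine (mu B) - fine (mu' B)| <= tv_distance mu mu'.
Proof.
move=> mB; apply: ub_le_sup; last by exists B.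
exists 1 => _ [A mA <-].
have b (nu : probability X R) : 0 <= fine (nu A) <= 1.
  rewrite fine_ge0//= -lee_fin fineK ?fin_num_measure//.
  exact: probability_le1.
by have := b mu; have := b mu'; rewrite ler_norml; lra.
Qed.

Lemma tv_le mu mu' e :
  (forall B, measurable B -> `|fine (mu B) - fine (mu' B)| <= e) ->
  tv_distance mu mu' <= e.
Proof.
move=> h; apply: ge_sup; last by move=> _ [B mB <-]; exact: h.
by exists `|fine (mu set0) - fine (mu' set0)|, set0.
Qed.

Lemma tv_metric : metric_on (fun mu mu' => measure_eq mu mu')
  [set: probability X R] (@tv_distance _ X R).
Proof.
split.
- by move=> mu mu' _ _; apply: le_trans (tv_ge mu mu' measurable0).
- move=> mu mu' _ _; split=> [tv0 B mB|mumu'].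
    have := tv_ge mu mu' mB.
    rewrite tv0 normr_le0 subr_eq0 => /eqP mumu'.
    rewrite -[LHS]fineK ?fin_num_measure// -[RHS]fineK ?fin_num_measure//.
    by congr EFin.
  apply/eqP; rewrite eq_le; apply/andP; split.
    by apply: tv_le => B mB; rewrite mumu'// subrr normr0.
  exact: le_trans (tv_ge mu mu' measurable0).
- move=> mu mu' _ _; congr sup; apply/seteqP.
  by split=> _ [B mB <-]; exists B => //; rewrite distrC.
- move=> mu1 mu2 mu3 _ _ _; apply: tv_le => B mB.
  apply: le_trans (ler_distD (fine (mu2 B)) _ _) _.
  by apply: lerD; exact: tv_ge.
Qed.

End tv_metric.

(** The Prokhorov distance is at most the total variation distance, as a set
    is contained in its enlargements. *)
Lemma prokhorov_le_tv (R : realType) (T : ptopologicalType) (d : T -> T -> R)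
    (dP : metric_for_topology d) (mu mu' : probability (borel T) R) :
  prokhorov (X := borel T) d mu mu' <= tv_distance mu mu'.
Proof.
have tv0 : 0 <= tv_distance mu mu'.
  by apply: le_trans (tv_ge mu mu' measurable0).
apply/ler_addgt0Pr => e e0.
apply: prokhorov_le; split; first exact: ltr_wpDl.
move=> B mB; set e' := _ + e.
have e'0 : 0 < e' by exact: ltr_wpDl.
apply: (@le_trans _ _ (mu' B + e'%:E)%E).
  have := tv_ge mu mu' mB; rewrite ler_norml => /andP[_].
  rewrite -[X in (X <= _)%E]fineK ?fin_num_measure//.
  rewrite -[X in (X + _)%E]fineK ?fin_num_measure//.
  by rewrite -EFinD lee_fin /e'; lra.
apply: leeD => //; rewrite le_measure ?inE//.
  exact: measurable_enlargement.
exact: sub_enlargement.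
Qed.

(** * The Hellinger metric *)

Section hellinger_metric.
Context {disp : measure_display} {X : measurableType disp} {R : realType}.
Variable prior : probability X R.
Implicit Types (mu : probability X R) (f g : X -> R).

Local Notation rn := (rn_density prior).

Lemma rn_densityE mu x : mu `<< prior ->
  (rn mu x)%:E = Radon_Nikodym (charge_of_finite_measure mu) prior x.
Proof. by move=> ac; rewrite fineK// Radon_Nikodym_fin_num. Qed.

Lemma integrable_rn_density mu : mu `<< prior ->
  prior.-integrable [set: X] (EFin \o rn mu).
Proof.
move=> ac; rewrite (_ : _ \o _ =
  Radon_Nikodym (charge_of_finite_measure mu) prior).
  exact: Radon_Nikodym_integrable.
by apply/funext => x; rewrite /= rn_densityE.
Qed.

Lemma measurable_rn_density mu : mu `<< prior ->
  measurable_fun [set: X] (rn mu).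
Proof.
by move=> ac; apply/measurable_EFinP/measurable_int/integrable_rn_density.
Qed.

Lemma integral_rn_density mu B : mu `<< prior -> measurable B ->
  mu B = (\int[prior]_(x in B) (rn mu x)%:E)%E.
Proof.
move=> ac mB; under eq_integral do rewrite rn_densityE//.
by rewrite -Radon_Nikodym_integral.
Qed.

Lemma rn_density_ge0 mu : mu `<< prior -> {ae prior, forall x, 0 <= rn mu x}.
Proof.
move=> ac; apply: filterS (ae_eq_Radon_Nikodym_SigmaFinite ac measurableT).
move=> x /(_ I) fE; rewrite -lee_fin rn_densityE//.
by rewrite -[X in (_ <= X)%E]fE Radon_Nikodym_SigmaFinite.f_ge0.
Qed.

Lemma rn_density_unique mu f : mu `<< prior -> measurable_fun [set: X] f ->
  (forall B, measurable B -> mu B = (\int[prior]_(x in B) (f x)%:E)%E) ->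
  {ae prior, forall x, rn mu x = f x}.
Proof.
move=> ac mf muf.
have : ae_eq prior [set: X] (EFin \o rn mu) (EFin \o f).
  apply: integral_ae_eq => //; first exact: integrable_rn_density.
    exact/measurable_EFinP.
  by move=> B _ mB; rewrite -integral_rn_density// muf.
by apply: filterS => x /(_ I)[].
Qed.

(** The L2 norm with respect to the prior; it is 0, by convention of the real
    integral, when [f ^+ 2] has an infinite integral. *)
Definition norm2 f : R := Num.sqrt (\int[prior]_x (f x) ^+ 2).

Lemma Lnorm_norm2 f : prior.-integrable [set: X] (fun x => (f x ^+ 2)%:E) ->
  ('N[prior]_2%:E[EFin \o f] = (norm2 f)%:E)%E.
Proof.
move=> if2.
have i0 : 0 <= \int[prior]_x (f x) ^+ 2.
  by apply: Rintegral_ge0 => x _; exact: sqr_ge0.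
rewrite unlock /norm2 -powR12_sqrt// -poweR_EFin; congr (_ `^ _)%E.
rewrite /Rintegral fineK; last exact: integrable_fin_num.
apply: eq_integral => x _ /=.
by rewrite powR_mulrn// real_normK// num_real.
Qed.

Lemma norm2_triangle f g :
  measurable_fun [set: X] f -> measurable_fun [set: X] g ->
  prior.-integrable [set: X] (fun x => (f x ^+ 2)%:E) ->
  prior.-integrable [set: X] (fun x => (g x ^+ 2)%:E) ->
  prior.-integrable [set: X] (fun x => ((f x + g x) ^+ 2)%:E) ->
  norm2 (f \+ g) <= norm2 f + norm2 g.
Proof.
move=> mf mg if2 ig2 ifg2; rewrite -lee_fin EFinD -!Lnorm_norm2//.
by apply: eminkowski => //; rewrite lee_fin ler1n.
Qed.

(** No sign is assumed: the square root of a negative number is 0. *)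
Lemma sqrB_sqrt_le (a b : R) : (Num.sqrt a - Num.sqrt b) ^+ 2 <= `|a - b|.
Proof.
wlog ba : a b / b <= a => [hw|].
  have [/hw//|/ltW/hw] := leP b a.
  by rewrite distrC -sqrrN opprB.
have [b0|/ltW b0] := leP 0 b.
  have a0 := le_trans b0 ba.
  rewrite -{2}(sqr_sqrtr a0) -{2}(sqr_sqrtr b0).
  have sba : Num.sqrt b <= Num.sqrt a by exact: ler_wsqrtr.
  have sb0 := sqrtr_ge0 b.
  by rewrite ger0_norm ?subr_ge0 ?ler_sqr ?nnegrE//; nra.
rewrite (ler0_sqrtr b0) subr0 ger0_norm ?subr_ge0//.
have [a0|/ltW a0] := leP 0 a; first by rewrite sqr_sqrtr//; lra.
by rewrite ler0_sqrtr// expr0n/= subr_ge0.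
Qed.

(** The square root of the density of [mu] with respect to the prior. *)
Definition sqrt_rn mu (x : X) : R := Num.sqrt (rn mu x).

Lemma measurable_sqrt_rn mu : mu `<< prior ->
  measurable_fun [set: X] (sqrt_rn mu).
Proof.
move=> ac; apply: measurableT_comp; last exact: measurable_rn_density.
by apply: continuous_measurable_fun; exact: sqrt_continuous.
Qed.

Lemma integrable_sqrt_rnB mu mu' : mu `<< prior -> mu' `<< prior ->
  prior.-integrable [set: X]
    (fun x => ((sqrt_rn mu' x - sqrt_rn mu x) ^+ 2)%:E).
Proof.
move=> ac ac'.
apply: (le_integrable measurableT _ _ (integrableB measurableT
  (integrable_rn_density ac') (integrable_rn_density ac))).
- apply/measurable_EFinP/measurable_funX/measurable_funB;
    exact: measurable_sqrt_rn.
- move=> x _ /=; rewrite lee_fin ger0_norm ?sqr_ge0//; exact: sqrB_sqrt_le.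
Qed.

Lemma hellingerE mu mu' :
  hellinger prior mu mu' = Num.sqrt 2^-1 * norm2 (sqrt_rn mu' \- sqrt_rn mu).
Proof. by rewrite /norm2 -sqrtrM. Qed.

Lemma hellinger_eq0 mu mu' : mu `<< prior -> mu' `<< prior ->
  hellinger prior mu mu' = 0 <-> measure_eq mu mu'.
Proof.
move=> ac ac'; split=> [|mumu'].
- move=> /eqP; rewrite hellingerE mulf_eq0 gt_eqF/= ?sqrtr_gt0 ?invr_gt0//.
  move=> /eqP N0.
  have L0 : ('N[prior]_2%:E[EFin \o (sqrt_rn mu' \- sqrt_rn mu)%R] = 0)%E.
    by rewrite Lnorm_norm2 ?N0//; exact: integrable_sqrt_rnB.
  have mB0 : measurable_fun [set: X] (EFin \o (sqrt_rn mu' \- sqrt_rn mu)%R).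
    by apply/measurable_EFinP/measurable_funB; exact: measurable_sqrt_rn.
  have p0 : (0 < 2%:E :> \bar R)%E by rewrite lte_fin.
  have h := Lnorm_eq0_eq0 mB0 p0 L0.
  move=> B mB; apply: etrans (integral_rn_density ac mB) _.
  apply: etrans _ (esym (integral_rn_density ac' mB)).
  apply: ae_eq_integral => //.
  + by apply/measurable_EFinP/measurable_funTS/measurable_rn_density.
  + by apply/measurable_EFinP/measurable_funTS/measurable_rn_density.
  + apply: filterS3 h (rn_density_ge0 ac) (rn_density_ge0 ac').
    move=> x /(_ I)/=[] /eqP; rewrite subr_eq0 => /eqP h mu0 mu'0 _.
    by rewrite -(sqr_sqrtr mu0) -(sqr_sqrtr mu'0) -/(sqrt_rn mu x) -h.
- have rnE : {ae prior, forall x, rn mu x = rn mu' x}.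
    apply: rn_density_unique => //; first exact: measurable_rn_density.
    move=> B mB; apply: etrans (mumu' B mB) _.
    exact: integral_rn_density.
  rewrite /hellinger /Rintegral.
  rewrite (ae_eq_integral (cst 0%E))//.
  + by rewrite integral0 mulr0 sqrtr0.
  + by apply/measurable_EFinP/measurable_funX/measurable_funB;
      exact: measurable_sqrt_rn.
  + by apply: filterS rnE => x -> _; rewrite subrr expr0n.
Qed.

Lemma hellinger_metric : metric_on (fun mu mu' => measure_eq mu mu')
  [set mu : probability X R | mu `<< prior] (hellinger prior).
Proof.
split.
- by move=> *; exact: sqrtr_ge0.
- by move=> mu mu'; exact: hellinger_eq0.
- move=> mu mu' _ _; congr (Num.sqrt (_ * _)).
  by apply: eq_Rintegral => x _; rewrite -sqrrN opprB.
- move=> mu1 mu2 mu3 ac1 ac2 ac3; rewrite !hellingerE -mulrDr.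
  rewrite ler_wpM2l ?sqrtr_ge0//.
  have E : sqrt_rn mu3 \- sqrt_rn mu1 =
      (sqrt_rn mu2 \- sqrt_rn mu1) \+ (sqrt_rn mu3 \- sqrt_rn mu2).
    by apply/funext => x /=; ring.
  rewrite E; apply: norm2_triangle; try exact: integrable_sqrt_rnB.
  + by apply: measurable_funB; exact: measurable_sqrt_rn.
  + by apply: measurable_funB; exact: measurable_sqrt_rn.
  + rewrite (_ : (fun _ => _) =
        fun x => ((sqrt_rn mu3 x - sqrt_rn mu1 x) ^+ 2)%:E).
      exact: integrable_sqrt_rnB.
    by apply/funext => x /=; congr (_ ^+ 2)%:E; ring.
Qed.

(** The Hellinger distance is controlled by the L1 distance of densities,
    because of [(sqrt a - sqrt b)^2 <= |a - b|]. *)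
Lemma hellinger_le_L1 mu mu' f f' :
  mu `<< prior -> mu' `<< prior ->
  prior.-integrable [set: X] (EFin \o f) ->
  prior.-integrable [set: X] (EFin \o f') ->
  (forall B, measurable B -> mu B = (\int[prior]_(x in B) (f x)%:E)%E) ->
  (forall B, measurable B -> mu' B = (\int[prior]_(x in B) (f' x)%:E)%E) ->
  hellinger prior mu mu' <= Num.sqrt (\int[prior]_x `|f' x - f x|).
Proof.
move=> ac ac' if_ if' muf mu'f'; apply: ler_wsqrtr.
have mf : measurable_fun [set: X] f
  by apply/measurable_EFinP/measurable_int/if_.
have mf' : measurable_fun [set: X] f'
  by apply/measurable_EFinP/measurable_int/if'.
set I := \int[prior]_x _.
have I0 : 0 <= I by apply: Rintegral_ge0 => x _; exact: sqr_ge0.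
apply: (@le_trans _ _ I); first by rewrite ler_piMl// invf_le1// ler1n.
apply: fine_le.
- by apply: integrable_fin_num => //; exact: integrable_sqrt_rnB.
- apply: integrable_fin_num => //.
  exact: (integrable_abse (integrableB measurableT if' if_)).
apply: ae_ge0_le_integral => //.
- by move=> x _; rewrite lee_fin sqr_ge0.
- exact: measurable_int (integrable_sqrt_rnB ac ac').
- by apply/measurable_EFinP/measurableT_comp => //; exact: measurable_funB.
apply: filterS2 (rn_density_unique ac mf muf) (rn_density_unique ac' mf' mu'f').
by move=> x -> -> _; rewrite lee_fin sqrB_sqrt_le.
Qed.

End hellinger_metric.
(** * Probability measures given by densities *)

Section density_measure.
Context {disp : measure_display} {T : measurableType disp} {R : realType}.
Variables (mu : {measure set T -> \bar R}) (f : T -> R).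
Hypotheses (mf : measurable_fun [set: T] f) (f0 : forall x, 0 <= f x).
Hypothesis f1 : (\int[mu]_x (f x)%:E = 1)%E.

Lemma density_probability_exists : exists P : probability T R,
  forall A, P A = (\int[mu]_(x in A) (f x)%:E)%E.
Proof.
pose P (A : set T) : \bar R := (\int[mu]_(x in A) (f x)%:E)%E.
have P0 : P set0 = 0%E by rewrite /P integral_set0.
have P_ge0 A : (0 <= P A)%E by apply: integral_ge0 => x _; rewrite lee_fin.
have Padd : semi_sigma_additive P.
  apply: semi_sigma_additive_nng_induced; first exact/measurable_EFinP.
  by move=> x; rewrite lee_fin.
have P1 : P setT = 1%E by [].
pose isP := isMeasure.Build _ _ _ P P0 P_ge0 Padd.
pose mP : {measure set T -> \bar R} := HB.pack P isP.
pose isPr := Measure_isProbability.Build _ _ _ mP P1.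
pose pP : probability T R := HB.pack P isP isPr.
by exists pP.
Qed.

End density_measure.

(** A measure with [f] as density with respect to the prior, itself of density
    [pi] with respect to [nu], has density [f * pi] with respect to [nu]. The
    function [f'] is a version of [f], only equal to it outside of a prior-null
    set; this set need not be [nu]-null, but [pi] vanishes almost everywhere
    on it. *)
Lemma is_density_mul (disp : measure_display) (T : measurableType disp)
    (R : realType) (nu : {sigma_finite_measure set T -> \bar R})
    (prior P : probability T R) (pi f f' : T -> R) :
  prior `<< nu -> is_density nu prior pi ->
  measurable_fun [set: T] f -> (forall x, 0 <= f x) ->
  measurable_fun [set: T] f' -> {ae prior, forall x, f' x = f x} ->
  (forall A, measurable A -> P A = (\int[prior]_(x in A) (f x)%:E)%E) ->
  is_density nu P (fun x => f' x * pi x).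
Proof.
move=> ac [mpi pi0 piE] mf f0 mf' f'f PE.
pose r := Radon_Nikodym_SigmaFinite.f prior nu.
have r0 x : (0 <= r x)%E by exact: Radon_Nikodym_SigmaFinite.f_ge0.
have ir : nu.-integrable [set: T] r.
  exact: Radon_Nikodym_SigmaFinite.f_integrable.
have mr : measurable_fun [set: T] r := measurable_int _ ir.
have rpi : {ae nu, forall x, r x = (pi x)%:E}.
  have : ae_eq nu [set: T] r (EFin \o pi).
    apply: integral_ae_eq => //; first exact/measurable_EFinP.
    by move=> E _ mE; rewrite -piE// -Radon_Nikodym_SigmaFinite.f_integral.
  by apply: filterS => x /(_ I).
pose N := [set x | f' x != f x].
have mN : measurable N.
  rewrite (_ : N = [set: T] `&` [set x | (EFin \o f') x != (EFin \o f) x]).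
    by apply: measurable_neqe => //; exact/measurable_EFinP.
  by rewrite setTI; apply/seteqP; split=> x /=; rewrite eqe.
have N0 : prior N = 0%E.
  apply/(negligibleP _ mN).
  case: f'f => E [mE E0 sE]; exists E; split=> // x /= /eqP xN.
  exact: sE.
(* The integral over [N] of the nonnegative [r] is [prior N = 0]. *)
have rN : {ae nu, forall x, N x -> r x = 0%E}.
  apply/(ae_eq_integral_abs nu mN); first exact: measurable_funTS.
  rewrite -N0 (Radon_Nikodym_SigmaFinite.f_integral ac)//.
  by apply: eq_integral => x _; rewrite gee0_abs.
have E : {ae nu, forall x, ((f' x * pi x)%:E = (f x)%:E * r x)%E}.
  apply: filterS2 rpi rN => x rx; rewrite rx /N/=.
  have [->//|_ /(_ isT)[->]] := eqVneq (f' x) (f x).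
  by rewrite mulr0 mule0.
split.
- exact: measurable_funM.
- apply: filterS E => x; rewrite -lee_fin => ->.
  by rewrite mule_ge0 ?lee_fin.
- move=> A mA; rewrite PE//.
  rewrite -(Radon_Nikodym_SigmaFinite.change_of_variables ac
    (f := EFin \o f))//.
  + apply: ae_eq_integral => //.
    * apply: emeasurable_funM; apply: measurable_funTS => //.
      exact/measurable_EFinP.
    * by apply: measurable_funTS; apply/measurable_EFinP/measurable_funM.
    * by apply: filterS E => x ->.
  + by apply: measurable_funTS; exact/measurable_EFinP.
Qed.

Lemma tv_le_L1 (disp : measure_display) (X : measurableType disp)
    (R : realType) (prior mu mu' : probability X R) (f f' : X -> R) :
  prior.-integrable [set: X] (EFin \o f) ->
  prior.-integrable [set: X] (EFin \o f') ->
  (forall B, measurable B -> mu B = (\int[prior]_(x in B) (f x)%:E)%E) ->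
  (forall B, measurable B -> mu' B = (\int[prior]_(x in B) (f' x)%:E)%E) ->
  tv_distance mu mu' <= \int[prior]_x `|f' x - f x|.
Proof.
move=> if_ if' muf mu'f'; apply: tv_le => B mB.
have iS (h : X -> R) : prior.-integrable [set: X] (EFin \o h) ->
    prior.-integrable B (EFin \o h).
  exact: integrableS.
have iB : prior.-integrable [set: X] (EFin \o (f' \- f)).
  exact: (integrableB measurableT if' if_).
rewrite muf// mu'f'// distrC.
rewrite -[fine _ - fine _](RintegralB mB (iS _ if') (iS _ if_)).
apply: (le_trans (le_normr_Rintegral mB (iS _ iB))).
apply: fine_le.
- by apply: integrable_fin_num => //; exact: (integrable_abse (iS _ iB)).
- by apply: integrable_fin_num => //; exact: (integrable_abse iB).
apply: ge0_subset_integral => //.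
by apply/measurable_EFinP/measurableT_comp => //;
  apply/measurable_EFinP/measurable_int/iB.
Qed.

(** * L1 continuity of the posterior density *)

(** [M] is the likelihood, made nonnegative for all parameters. *)
Section L1_continuity.
Context {disp : measure_display} {X : measurableType disp} {R : realType}.
Variables (prior : probability X R) (Y : pseudoMetricType R).
Variables (M : Y -> X -> R) (g : X -> R).
Hypothesis iM : forall y, prior.-integrable [set: X] (EFin \o M y).
Hypothesis M0 : forall y t, 0 <= M y t.
Hypothesis ig : prior.-integrable [set: X] (EFin \o g).
Hypothesis Mg : {ae prior, forall t, forall y, M y t <= g t}.
Hypothesis cM : {ae prior, forall t, continuous (M ^~ t)}.

Local Notation Z y := (\int[prior]_t M y t).

Lemma L1_likelihood_cvg y0 :
  \int[prior]_t `|M y t - M y0 t| @[y --> y0] --> (0 : R).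
Proof.
apply: cvg_at_seq => u uy0.
have mM y : measurable_fun [set: X] (EFin \o M y).
  exact: measurable_int (iM y).
have [] := @dominated_convergence _ X R prior setT measurableT
  (fun n => EFin \o M (u n)) (EFin \o M y0) (EFin \o g)
  (fun n => mM (u n)) (mM y0)
  _ ig.
- apply: filterS cM => t cMt _; apply/cvg_EFin; first exact: nearW.
  exact: (cvg_comp _ _ uy0 (cMt y0)).
- apply: filterS Mg => t Mgt n _ /=; rewrite lee_fin ger0_norm//.
move=> _ /fine_cvgP[_ h] _; exact: h.
Qed.

Lemma posterior_L1_le y y0 : 0 < Z y -> 0 < Z y0 ->
  \int[prior]_t `|M y t / Z y - M y0 t / Z y0| <=
  2 / Z y0 * \int[prior]_t `|M y t - M y0 t|.
Proof.
move=> Zy Zy0; set D := \int[prior]_t `|M y t - M y0 t|.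
pose c := `|Z y0 - Z y| / (Z y * Z y0).
have iD : prior.-integrable [set: X] (EFin \o (fun t => M y t - M y0 t)).
  exact: (integrableB measurableT (iM y) (iM y0)).
have iaD : prior.-integrable [set: X] (EFin \o (fun t => `|M y t - M y0 t|)).
  exact: (integrable_abse iD).
have iZl a h : prior.-integrable [set: X] (EFin \o h) ->
    prior.-integrable [set: X] (EFin \o (fun t => a * h t)).
  exact: integrableZl.
have ZD : `|Z y0 - Z y| <= D.
  rewrite distrC -RintegralB//.
  exact: le_normr_Rintegral.
have pw t : `|M y t / Z y - M y0 t / Z y0| <=
    c * M y t + (Z y0)^-1 * `|M y t - M y0 t|.
  rewrite (_ : _ - _ = (Z y0 - Z y) / (Z y * Z y0) * M y t
      + (Z y0)^-1 * (M y t - M y0 t)); last by field; rewrite !gt_eqF.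
  apply: (le_trans (ler_normD _ _)); rewrite !normrM !normfV.
  rewrite (ger0_norm (M0 y t)) (gtr0_norm Zy0) (gtr0_norm (mulr_gt0 Zy Zy0)).
  by [].
apply: (@le_trans _ _
  (\int[prior]_t (c * M y t + (Z y0)^-1 * `|M y t - M y0 t|))).
  apply: le_Rintegral => //.
    rewrite (_ : _ \o _ =
        EFin \o (fun t => `|(Z y)^-1 * M y t - (Z y0)^-1 * M y0 t|)).
      exact: (integrable_abse (integrableB measurableT (iZl _ _ (iM y))
        (iZl _ _ (iM y0)))).
    by apply/funext => t /=; rewrite !(mulrC (_^-1)).
  exact: (integrableD measurableT (iZl _ _ (iM y)) (iZl _ _ iaD)).
rewrite RintegralD ?RintegralZl//; [|exact: iZl..].
rewrite -/D (_ : c * _ = `|Z y0 - Z y| / Z y0); last first.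
  by rewrite /c; field; rewrite !gt_eqF.
rewrite (_ : 2 / _ * D = (D + D) / Z y0); last by field; rewrite gt_eqF.
rewrite (mulrC _^-1) -mulrDl; apply: ler_wpM2r; last by rewrite lerD2r.
by rewrite invr_ge0 ltW.
Qed.

(** The normalised likelihood is continuous in the data as a map to L1. *)
Lemma posterior_L1_cvg y0 : (forall y, 0 < Z y) ->
  \int[prior]_t `|M y t / Z y - M y0 t / Z y0| @[y --> y0] --> (0 : R).
Proof.
move=> Z0.
apply: (@squeeze_cvgr _ _ _ _ (cst 0)
  (fun y => 2 / Z y0 * \int[prior]_t `|M y t - M y0 t|)).
- apply: nearW => y; rewrite posterior_L1_le// andbT.
  by apply: Rintegral_ge0 => t _.
- exact: cvg_cst.
- rewrite -[X in _ --> X](mulr0 (2 / Z y0)).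
  by apply: cvgMr; exact: L1_likelihood_cvg.
Qed.

End L1_continuity.

(** * Well-posedness *)

Lemma Rintegral_gt0 (disp : measure_display) (T : measurableType disp)
    (R : realType) (P : probability T R) (f : T -> R) :
  (forall x, 0 <= f x) -> P.-integrable [set: T] (EFin \o f) ->
  {ae P, forall x, 0 < f x} -> 0 < \int[P]_x f x.
Proof.
move=> f0 if_ fgt0; rewrite lt_neqAle Rintegral_ge0// andbT eq_sym.
apply/eqP => If0.
have I0 : (\int[P]_x `|(f x)%:E| = 0)%E.
  rewrite -[RHS]/(0%R)%:E -If0 fineK ?integrable_fin_num//.
  by apply: eq_integral => x _; rewrite gee0_abs// lee_fin.
have fae0 := (ae_eq_integral_abs P measurableT (measurable_int _ if_)).1 I0.
have [N [mN N0 sN]] : {ae P, forall x : T, False}.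
  by apply: filterS2 fae0 fgt0 => x /(_ I)[->]; rewrite ltxx.
have := probability_setT P; rewrite (_ : setT = N) ?N0; last first.
  by apply/seteqP; split=> // x _; exact: sN.
by move=> /eqP; rewrite eq_sym onee_eq0.
Qed.

Theorem theorem3p6 (R : realType)
  (* data space *)
  (Y : completeNormedModType R) (sepY : separable Y)
  (* parameter space *)
  (X' : topologicalLmodType R) (sepX' : separable X')
  (cmX' : completely_metrizable (R := R) X')
  (Xset : set X') (mX : <<s @open X' >> Xset) (x0 : Xset)
  (X := pointed_subspace x0)
  (dX : X -> X -> R) (dXP : metric_for_topology dX)
  (* reference measures, prior, conditional distribution of the data *)
  (nuX : {sigma_finite_measure set (borel X) -> \bar R})
  (nuY : {sigma_finite_measure set (borel Y) -> \bar R})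
  (prior : probability (borel X) R) (pi_prior : borel X -> R)
  (prior_dom : prior `<< nuX) (prior_pi : is_density nuX prior pi_prior)
  (K : R.-pker borel X ~> borel Y)
  (L : borel Y -> borel X -> R) (hL : is_likelihood nuY prior K L)
  (A1 : {ae prior, forall t,
          (forall y, 0 < L y t) /\ is_prob_density nuY (L ^~ t)})
  (A2 : forall y, prior.-integrable [set: borel X] (EFin \o L y))
  (A3 : exists2 g : borel X -> R,
          prior.-integrable [set: borel X] (EFin \o g) &
          {ae prior, forall t, forall y, L y t <= g t})
  (A4 : {ae prior, forall t, continuous (fun y : Y => L y t)}) :
  let post : Y -> set (probability (borel X) R) :=
    posterior nuX prior pi_prior L in
  [/\ well_posed post [set: probability (borel X) R] (prokhorov (X := borel X) dX),
      well_posed post [set mu : probability (borel X) R | mu `<< prior]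
        (hellinger prior) &
      well_posed post [set: probability (borel X) R] (tv_distance (R := R))].
Proof.
move=> post.
have Lgt0 : {ae prior, forall t, forall y, 0 < L y t}.
  by apply: filterS A1 => t [].
have [g ig Lg] := A3.
(* [M] is a version of the likelihood that is nonnegative everywhere. *)
pose M (y : Y) (t : borel X) : R := `|L y t|.
have M0 y t : 0 <= M y t by exact: normr_ge0.
have LM : {ae prior, forall t, forall y, L y t = M y t}.
  by apply: filterS Lgt0 => t h y; rewrite /M gtr0_norm.
have LMy y : {ae prior, forall t, L y t = M y t} by apply: filterS LM.
have mL (y : Y) : measurable_fun [set: borel X] (L y).
  by apply/measurable_EFinP/measurable_int/A2.
have iM y : prior.-integrable [set: borel X] (EFin \o M y).
  exact: (integrable_abse (A2 y)).
have mM y : measurable_fun [set: borel X] (M y) by exact: measurableT_comp.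
have Mg : {ae prior, forall t, forall y, M y t <= g t}.
  by apply: filterS2 LM Lg => t LMt Lgt y; rewrite -LMt.
have cM : {ae prior, forall t, continuous (M ^~ t)}.
  apply: filterS2 LM A4 => t LMt cLt.
  by rewrite (_ : M ^~ t = (fun y : Y => L y t))//; apply/funext.
pose Z y := \int[prior]_t M y t.
have ZE y : evidence prior L y = Z y.
  rewrite /evidence /Z /Rintegral; congr fine; apply: ae_eq_integral => //.
  - exact/measurable_EFinP.
  - exact/measurable_EFinP.
  - by apply: filterS (LMy y) => t -> _.
have Z0 y : 0 < Z y.
  apply: Rintegral_gt0 => //; apply: filterS2 LM Lgt0 => t LMt Lt.
  by rewrite -LMt.
pose f y t := M y t / Z y.
have f0 y t : 0 <= f y t by rewrite divr_ge0// ltW.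
have mf y : measurable_fun [set: borel X] (f y) by exact: measurable_funM.
have if_ y : prior.-integrable [set: borel X] (EFin \o f y).
  exact: (integrableZr measurableT (Z y)^-1 (iM y)).
have If y : (\int[prior]_t (f y t)%:E = 1)%E.
  rewrite -[LHS]fineK; last exact: (integrable_fin_num measurableT (if_ y)).
  have If1 : \int[prior]_t f y t = 1 
    by rewrite (RintegralZr _ measurableT (iM y)) divff ?(gt_eqF (Z0 y)).
  by rewrite -[RHS]/(1%R)%:E -If1.
have [mupost mupostE] :=
  choice (fun y => density_probability_exists (mf y) (f0 y) (If y)).
have mupost_prior y : mupost y `<< prior.
  apply/null_content_dominatesP => A mA A0; rewrite mupostE.
  by apply: null_set_integral => //; exact/measurable_funTS/measurable_EFinP.
have post_mupost y : post y (mupost y).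
  split; first exact: mupost_prior.
  rewrite (_ : (fun _ => _) = fun t => L y t / Z y * pi_prior t); last first.
    by apply/funext => t; rewrite ZE mulrAC.
  apply: (is_density_mul prior_dom prior_pi (mf y)) => //.
  - exact: measurable_funM.
  - by apply: filterS (LMy y) => t ->.
have post_unique y mu : post y mu -> measure_eq mu (mupost y).
  move=> [_ [_ _ muE]] B mB; have [_ [_ _ mupostB]] := post_mupost y.
  by apply: etrans (muE B mB) (esym (mupostB B mB)).
have fcvg y0 : \int[prior]_t `|f y t - f y0 t| @[y --> y0] --> (0 : R).
  exact: (posterior_L1_cvg (prior := prior) iM M0 ig Mg cM).
have tv_cvg y0 : tv_distance (mupost y0) (mupost y) @[y --> y0] --> (0 : R).
  apply: (squeeze_cvgr _ (cvg_cst 0) (fcvg y0)).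
  apply: nearW => y; rewrite (le_trans _ (tv_ge _ _ measurable0))//=.
  by apply: (tv_le_L1 (prior := prior)).
split.
- split; first exact: prokhorov_metric.
  exists mupost; split=> // [y mu _|y0]; first exact: post_unique.
  apply: (squeeze_cvgr _ (cvg_cst 0) (tv_cvg y0)).
  by apply: nearW => y; rewrite prokhorov_ge0//= prokhorov_le_tv.
- split; first exact: hellinger_metric.
  exists mupost; split=> [y|y mu _|y0]; first by split=> //; exact: mupost_prior.
    exact: post_unique.
  apply: (@squeeze_cvgr _ _ _ _ (cst 0)
    (fun y => Num.sqrt (\int[prior]_t `|f y t - f y0 t|))).
  + apply: nearW => y; rewrite sqrtr_ge0/=.
    exact: hellinger_le_L1.
  + exact: cvg_cst.
  + rewrite -(sqrtr0 R).
    by apply: (cvg_comp _ _ (fcvg y0)); exact: sqrt_continuous.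
- split; first exact: tv_metric.
  by exists mupost; split=> // y mu _; exact: post_unique.
Qed.
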